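(* Let $n\ge 2$. There exists a bijection $\phi_n:\mathrm{sPF}(K_{n+1})\longrightarrow \mathcal{U}_n$ from the set of spherical $K_{n+1}$-parking functions to the set of uprooted trees on $[n]$ such that \[ \mathrm{sum}(\mathcal{P})=\binom{n}{2}-\kappa(K_n,\phi_n(\mathcal{P}))+1\qquad\text{for all }\mathcal{P}\in \mathrm{sPF}(K_{n+1}). \]
   Context: $\mathbb{N}=\{0,1,2,\dots\}$, $[n]=\{1,\dots,n\}$. $K_{n+1}$ is the complete simple graph on $V=\{0,1,\dots,n\}$ with root $0$, and $K_n=K_{n+1}-\{0\}$ is the complete graph on $[n]$. Spherical parking functions: let $R=\mathbb{K}[x_1,\dots,x_n]$ over a field $\mathbb{K}$. For an undirected loopless graph $G$ on $V$ with $a_{ij}$ edges between $i$ and $j$, and $\emptyset\ne A\subseteq[n]$, put $d_A(i)=\sum_{j\in V\setminus A}a_{ij}$ and $m_A=\prod_{i\in A}x_i^{d_A(i)}$. Let $\mathcal{M}_G=\langle m_A:\emptyset\neq A\subseteq[n]\rangle$ and $\mathcal{M}_G^{(k)}=\langle m_A:\emptyset\ne A\subseteq[n],\ |A|\le k+1\rangle$ for $0\le k\le n-1$. Then $\mathrm{sPF}(G)=\{\mathcal{P}=(p_1,\dots,p_n)\in\mathbb{N}^n:\ \prod_i x_i^{p_i}\in\mathcal{M}_G\setminus\mathcal{M}_G^{(n-2)}\}$, and $\mathrm{sum}(\mathcal{P})=\sum_{i=1}^n p_i$. Uprooted trees: a rooted labelled tree $T$ on vertex set $[n]$ is uprooted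 if its root is larger than all children of the root. $\mathcal{U}_n$ is the set of uprooted trees on $[n]$ (any element of $[n]$ may be the root). $\kappa$-number: let $T$ be a spanning tree of a graph $H$, rooted at $r$. For a non-root vertex $i$, $\mathrm{par}_T(i)$ denotes its parent; $i$ is an ancestor of $j\neq i$ if $i$ lies on the path in $T$ from $r$ to $j$. Then $\kappa(H,T)=\sum |E(\mathrm{par}_T(i),j)|$, the sum over all pairs $(i,j)$ of non-root vertices with $i$ an ancestor of $j$ in $T$ and $i>j$, where $|E(u,v)|$ is the number of edges of $H$ between $u$ and $v$. *)

(* Defs.v *)
From mathcomp Require Import all_boot all_order all_algebra.
From mathcomp Require Import boolp classical_sets functions mpoly.

Set Implicit Arguments.
Unset Strict Implicit.
Unset Printing Implicit Defensive.

Import GRing.Theory.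

(* Loopless undirected multigraphs; [mult G u v] is the number of edges between
   u and v. *)
Record mgraph (V : finType) := MGraph {
  mult : V -> V -> nat;
  mult_sym : forall u v, mult u v = mult v u;
  mult_loopless : forall u, mult u u = 0%N }.

Lemma complete_sym (V : finType) (u v : V) : nat_of_bool (u != v) = (v != u).
Proof. by rewrite eq_sym. Qed.

Lemma complete_loopless (V : finType) (u : V) : nat_of_bool (u != u) = 0%N.
Proof. by rewrite eqxx. Qed.

Definition complete_graph (V : finType) : mgraph V :=
  MGraph (@complete_sym V) (@complete_loopless V).

(* The vertex set V = {0, ..., n} is 'I_n.+1 with root ord0.  The set
   [n] = {1, ..., n} is 'I_n, where i : 'I_n stands for the label i + 1; it is
   embedded in V by the increasing map [lift ord0]. *)

Section SphericalParkingFunctions.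

Local Open Scope ring_scope.

Definition ideal_gen (R : comNzRingType) (I : finType) (D : pred I)
    (g : I -> R) : set R :=
  fun f => exists c : I -> R, f = \sum_(i | D i) c i * g i.

Variables (K : fieldType) (n : nat) (G : mgraph 'I_n.+1).

Definition outdeg (A : {set 'I_n}) (i : 'I_n) : nat :=
  (\sum_(j in ~: (lift ord0 @: A)) mult G (lift ord0 i) j)%N.

Definition gen_monomial (A : {set 'I_n}) : {mpoly K[n]} :=
  \prod_(i in A) 'X_i ^+ outdeg A i.

Definition parking_ideal : set {mpoly K[n]} :=
  ideal_gen (fun A : {set 'I_n} => A != finset.set0) gen_monomial.

Definition skeleton_ideal (k : nat) : set {mpoly K[n]} :=
  ideal_gen (fun A : {set 'I_n} => (A != finset.set0) && (#|A| <= k.+1)%N)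
    gen_monomial.

(* Vectors of N^n are multinomials P : 'X_{1..n}.  The index n - 2 is a
   truncated subtraction, hence only meaningful for n >= 2. *)
Definition sPF : set 'X_{1..n} :=
  fun P => parking_ideal 'X_[P] /\ ~ skeleton_ideal (n - 2) 'X_[P].

End SphericalParkingFunctions.

Section RootedTrees.

Variable V : finType.

Record rooted_graph := RootedGraph {
  root : V;
  edges : {set {set V}} }.

Implicit Type T : rooted_graph.

Definition adj T : rel V := fun u v => [set u; v]%SET \in edges T.

Definition simple_path T (u : V) (p : seq V) (v : V) : Prop :=
  [/\ path (adj T) u p, last u p = v & uniq (u :: p)].

Definition rooted_tree T : Prop :=
  [/\ forall e, e \in edges T -> #|e| = 2,
      forall u v, exists p, simple_path T u p v
    & forall c, (2 < size c)%N -> ~ ucycle (adj T) c].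

(* In a tree the simple path p from the root to j is unique. *)
Definition ancestor T (i j : V) : bool :=
  (i != j) && `[< exists2 p, simple_path T (root T) p j & i \in root T :: p >].

(* For a non-root vertex i of a tree, exactly one vertex qualifies; the default
   value is only used for the root. *)
Definition par T (i : V) : V :=
  odflt i [pick u | adj T u i && ancestor T u i].

End RootedTrees.

Definition kappa (n : nat) (H : mgraph 'I_n) (T : rooted_graph 'I_n) : nat :=
  (\sum_(i < n | i != root T)
     \sum_(j < n | [&& j != root T, ancestor T i j & (j < i)%N])
        mult H (par T i) j)%N.

Definition uprooted (n : nat) : set (rooted_graph 'I_n) :=
  fun T => rooted_tree T /\
    (forall i : 'I_n, i != root T -> par T i = root T -> (i < root T)%N).

(* Main.v *)
(* Subtracting 1 from every entry turns sPF(K_{n+1}) into the prime parking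
   functions of length n.  The root r of the tree attached to P is the largest
   vertex with P r = 1.  From r one runs the depth-first burning algorithm: the
   current vertex u checks the unburnt vertices j in decreasing order; if the
   value at j is 0, then j burns, becomes a child of u, and the search moves to
   j; otherwise the value at j drops by 1.  The run is determined by P, and also
   by the tree alone, since a check of j at u burns j exactly when u is the
   parent of j.  Every pair of vertices is a tree edge, a check that lowered a
   value, or a check that never happened because j burnt as a descendant of a
   child i > j of the checking vertex; the last kind is counted by kappa, so
   counting pairs gives the formula. *)
Require Import Defs.
From mathcomp Require Import all_boot all_order all_algebra.
From mathcomp Require Import boolp classical_sets functions mpoly.
From mathcomp Require Import zify.
From mathcomp.boot Require Import finset.

Set Implicit Arguments.
Unset Strict Implicit.
Unset Printing Implicit Defensive.

(** Acyclicity of a parent function in set form: a cycle of [f] inside [S] would be a nonempty set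
    closed under [f]. This form suits inductions that remove one vertex of [S] at a time. *)
Definition grounded (V : finType) (S : {set V}) (f : V -> V) :=
  forall A : {set V}, A \subset S -> A != set0 ->
    exists2 j, j \in A & f j \notin A.

Lemma fconnect_fpath (V : finType) (f : V -> V) (r u : V) (p : seq V) (i : V) :
  f r = r -> fpath f u p -> last u p = r -> fconnect f u i = (i \in u :: p).
Proof.
move=> fr; elim: p u => [|v p IH] u /=.
  move=> _ ->; rewrite inE; apply/idP/eqP => [/iter_findex <-|->]; last exact: connect0.
  by rewrite iter_fix.
case/andP=> /eqP fu pv lv; rewrite fconnect_eqVf fu IH // !inE.
by rewrite (eq_sym i u).
Qed.

(** * Runs of the burning algorithm *)

Section Burning.

Variable n : nat.
Implicit Types (S A : {set 'I_n}) (c : nat) (p : seq 'I_n) (i j u : 'I_n).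
Implicit Types (Q : 'I_n -> nat) (f : 'I_n -> 'I_n).

(* The run of the burning algorithm: [S] is the set of unburnt vertices, [p] the
   tree path from the current vertex up to the root, [Q] the current values, and
   the current vertex still has to check the vertices [j < c] of [S].  When it is
   done, its parent resumes with the vertices below it ([BurnPop]). *)
Inductive burn f : {set 'I_n} -> nat -> seq 'I_n -> ('I_n -> nat) -> Prop :=
| BurnDone c p Q : burn f set0 c p Q
| BurnPop S u p Q : burn f S u p Q -> burn f S 0 (u :: p) Q
| BurnSkip S j u p Q : j \notin S -> burn f S j (u :: p) Q ->
    burn f S j.+1 (u :: p) Q
| BurnFire S j u p Q : j \in S -> Q j = 0 -> f j = u ->
    burn f (S :\ j) n (j :: u :: p) Q -> burn f S j.+1 (u :: p) Q
| BurnDamp S j u p Q : j \in S -> 0 < Q j -> f j != u ->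
    burn f S j (u :: p) (fun i => Q i - (i == j)) -> burn f S j.+1 (u :: p) Q.

(** The measure drops by one in every move: a path vertex [u] weighs [u + 1] because popping it sets
    the counter to [u], and burning [j] gives up [n + 1] while the counter goes from [j + 1] to [n]
    and [j] adds [j + 1]. Both outcomes of a check are offered, so the same induction serves runs
    driven by [Q] and runs driven by [f]. *)
Lemma state_ind (Phi : {set 'I_n} -> nat -> seq 'I_n -> Prop) :
  (forall c p, Phi set0 c p) ->
  (forall S c, S != set0 -> Phi S c [::]) ->
  (forall S u p, Phi S u p -> Phi S 0 (u :: p)) ->
  (forall S j u p, j \notin S -> Phi S j (u :: p) -> Phi S j.+1 (u :: p)) ->
  (forall S j u p, j \in S -> Phi (S :\ j) n (j :: u :: p) ->
     Phi S j (u :: p) -> Phi S j.+1 (u :: p)) ->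
  forall S c p, c <= n -> Phi S c p.
Proof.
move=> H0 Hnil Hpop Hskip Hstep S c p.
have [m] := ubnP (#|S| * n.+1 + (c + sumn [seq (val u).+1 | u <- p])).
elim: m S c p => // m IH S c [|u p] lem cn.
  by have [->|] := eqVneq S set0; [exact: H0 | exact: Hnil].
case: c cn lem => [|c] cn lem /=.
  by apply: Hpop; apply: IH; [move: lem => /=; lia | apply/ltnW].
have [jS|jS] := boolP (Ordinal cn \in S); last first.
  apply: (Hskip S (Ordinal cn)) => //; apply: IH => /=; last exact: ltnW.
  by move: lem => /=; lia.
apply: (Hstep S (Ordinal cn)) => //; apply: IH => //=; last exact: ltnW.
  by move: lem => /=; rewrite (cardsD1 (Ordinal cn) S) jS add1n mulSn; move: (_ * n.+1) (sumn _) => a b; lia.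
by move: lem => /=; lia.
Qed.

Lemma burn_step_inv f S j u p Q : burn f S j.+1 (u :: p) Q ->
  [\/ S = set0,
      j \notin S /\ burn f S j (u :: p) Q,
      [/\ j \in S, Q j = 0, f j = u & burn f (S :\ j) n (j :: u :: p) Q]
    | [/\ j \in S, 0 < Q j, f j != u
        & burn f S j (u :: p) (fun i => Q i - (i == j))]].
Proof.
move: {-2}j.+1 (erefl j.+1) {-2}(u :: p) (erefl (u :: p)) => c Ec q Eq B.
case: B Ec Eq => //; first by constructor 1.
- move=> {}S j' u' p' {}Q jS B [/val_inj Ej] [Eu Ep]; move: B jS; rewrite Ej Eu Ep.
  by constructor 2.
- move=> {}S j' u' p' {}Q jS Qj fj B [/val_inj Ej] [Eu Ep]; move: B jS Qj fj; rewrite Ej Eu Ep.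
  by constructor 3.
- move=> {}S j' u' p' {}Q jS Qj fj B [/val_inj Ej] [Eu Ep]; move: B jS Qj fj; rewrite Ej Eu Ep.
  by constructor 4.
Qed.

Lemma burn_pop_inv f S u p Q : burn f S 0 (u :: p) Q ->
  S = set0 \/ burn f S u p Q.
Proof.
move: {-1}0 (erefl 0) {-2}(u :: p) (erefl (u :: p)) => c Ec q Eq B.
case: B Ec Eq => //; first by left.
by move=> {}S u' p' {}Q B _ [Eu Ep]; move: B; rewrite Eu Ep; right.
Qed.

Lemma burn_nil_inv f S c Q : burn f S c [::] Q -> S = set0.
Proof. by move: {-2}[::] (erefl ([::] : seq 'I_n)) => p Ep B; case: B Ep. Qed.

Lemma burn_ext f f' S c p Q Q' : c <= n -> {in S, f =1 f'} -> {in S, Q =1 Q'} ->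
  burn f S c p Q -> burn f' S c p Q'.
Proof.
move=> cn; move: Q Q'; elim/state_ind: S c p / cn.
- by move=> c p Q Q' _ _ _; apply: BurnDone.
- by move=> S c S0 Q Q' _ _ /burn_nil_inv E; rewrite E eqxx in S0.
- move=> S u p IH Q Q' ff QQ /burn_pop_inv[->|B]; first exact: BurnDone.
  by apply: BurnPop; apply: IH ff QQ B.
- move=> S j u p jS IH Q Q' ff QQ /burn_step_inv[->|[_ B]|[jS' _ _ _]|[jS' _ _ _]].
  + exact: BurnDone.
  + by apply: BurnSkip jS _; apply: IH ff QQ B.
  + by rewrite jS' in jS.
  + by rewrite jS' in jS.
- move=> S j u p jS IH1 IH2 Q Q' ff QQ.
  case/burn_step_inv=> [E|[jS' B]|[_ Qj fj B]|[_ Qj fj B]].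
  + by rewrite E inE in jS.
  + by rewrite jS in jS'.
  + apply: BurnFire; rewrite -?QQ -?ff //.
    by apply: IH1 B => i /setD1P[_ iS]; [apply: ff|apply: QQ].
  + apply: BurnDamp; rewrite -?QQ -?ff //.
    by apply: IH2 B => // i iS; rewrite QQ.
Qed.

(** The values drive the run: [Q j = 0] or [0 < Q j] selects the rule, and each burn fixes [f j]. *)
Lemma burn_inj_f f f' S c p Q : c <= n -> burn f S c p Q -> burn f' S c p Q ->
  {in S, f =1 f'}.
Proof.
move=> cn; move: Q; elim/state_ind: S c p / cn.
- by move=> c p Q _ _ i; rewrite inE.
- by move=> S c S0 Q /burn_nil_inv E; rewrite E eqxx in S0.
- move=> S u p IH Q /burn_pop_inv[-> _ i|B]; first by rewrite inE.
  by case/burn_pop_inv=> [-> i|B']; [rewrite inE | exact: IH B B'].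
- move=> S j u p jS IH Q.
  case/burn_step_inv=> [-> _ i|[_ B]|[jS']|[jS']]; rewrite ?inE //;
    try by rewrite jS' in jS.
  case/burn_step_inv=> [-> i|[_ B']|[jS']|[jS']]; rewrite ?inE //;
    try by rewrite jS' in jS.
  exact: IH B B'.
- move=> S j u p jS IH1 IH2 Q.
  case/burn_step_inv=> [-> _ i|[/negP[] //]|[_ Qj fj B]|[_ Qj fj B]];
    rewrite ?inE ?jS //;
  case/burn_step_inv=> [-> i|[/negP[] //]|[_ Qj' fj' B']|[_ Qj' fj' B']];
    rewrite ?inE ?jS //; try by lia.
  + move=> i iS; have [->|ij] := eqVneq i j; first by rewrite fj fj'.
    by apply: (IH1 _ B B'); rewrite !inE ij.
  + exact: IH2 B B'.
Qed.

(** The parents drive the run as well: [f j = u] or not selects the rule, and [Q j] is the number of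
    checks that [j] survives. *)
Lemma burn_inj_Q f S c p Q Q' : c <= n -> burn f S c p Q -> burn f S c p Q' ->
  {in S, Q =1 Q'}.
Proof.
move=> cn; move: Q Q'; elim/state_ind: S c p / cn.
- by move=> c p Q Q' _ _ i; rewrite inE.
- by move=> S c S0 Q Q' /burn_nil_inv E; rewrite E eqxx in S0.
- move=> S u p IH Q Q' /burn_pop_inv[-> _ i|B]; first by rewrite inE.
  by case/burn_pop_inv=> [-> i|B']; [rewrite inE | exact: IH B B'].
- move=> S j u p jS IH Q Q'.
  case/burn_step_inv=> [-> _ i|[_ B]|[jS']|[jS']]; rewrite ?inE //;
    try by rewrite jS' in jS.
  case/burn_step_inv=> [-> i|[_ B']|[jS']|[jS']]; rewrite ?inE //;
    try by rewrite jS' in jS.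
  exact: IH B B'.
- move=> S j u p jS IH1 IH2 Q Q'.
  case/burn_step_inv=> [-> _ i|[/negP[] //]|[_ Qj fj B]|[_ Qj fj B]];
    rewrite ?inE ?jS //;
  case/burn_step_inv=> [-> i|[/negP[] //]|[_ Qj' fj' B']|[_ Qj' fj' B']];
    rewrite ?inE ?jS //; try by move: fj fj' => /eqP + /negP.
    all: try by move: fj fj' => /negP + /eqP.
  + move=> i iS; have [->|ij] := eqVneq i j; first by rewrite Qj Qj'.
    by apply: (IH1 _ _ B B'); rewrite !inE ij.
  + move=> i iS; have := IH2 _ _ B B' i iS.
    by have [->|ij] := eqVneq i j; lia.
Qed.

(* The number of vertices of the path [p] that still have to check [j]. *)
Fixpoint slots c p (j : nat) : nat :=
  if p is u :: p' then (j < c) + slots u p' j else 0.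

Fixpoint allowed c p (j : nat) (v : 'I_n) : bool :=
  if p is u :: p' then (v == u) && (j < c) || allowed u p' j v else false.

(** The parking condition relative to a state: the bound counts the checks of [j] that can still
    come from outside [A], those pending on the path and one from each vertex of [S :\: A]. *)
Definition parking S c p Q := forall A, A \subset S -> A != set0 ->
  exists2 j, j \in A & Q j < slots c p j + #|S :\: A|.

Definition attached S c p f := {in S, forall j, (f j \in S) || allowed c p j (f j)}.

Definition clear S p := uniq p /\ {in p, forall i, i \notin S}.

Lemma clear_pop S u p : clear S (u :: p) -> clear S p.
Proof.
by case=> /= /andP[_ up] H; split=> // i ip; apply: H; rewrite inE ip orbT.
Qed.

Lemma clear_fire S j u p : j \in S -> clear S (u :: p) -> clear (S :\ j) (j :: u :: p).
Proof.
move=> jS [up H]; split; first by rewrite cons_uniq up andbT; apply: contraL jS => /H.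
by move=> i; rewrite !(inE, negb_and) => /predU1P[->|ip]; rewrite ?eqxx ?(H i) ?orbT.
Qed.

Lemma allowed_mem c p (j : nat) v : allowed c p j v -> v \in p.
Proof.
elim: p c => //= u p IH c; rewrite inE => /orP[/andP[->//]|/IH->].
by rewrite orbT.
Qed.

Lemma slots_fire j u p i : i != j ->
  slots n (j :: u :: p) i = (slots j.+1 (u :: p) i).+1.
Proof. by rewrite /= ltn_ord -val_eqE /= => ij; lia. Qed.

Lemma slots_skip j u p i : slots j.+1 (u :: p) i = slots j (u :: p) i + (i == j).
Proof. by rewrite /= -val_eqE /=; lia. Qed.

(** When [j] burns, its parent [u] is already burnt, so [j] is a witness for every [A] containing
    it; the other sets are handled by the rest of the run. *)
Lemma burn_grounded f S c p Q : c <= n -> clear S p -> burn f S c p Q ->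
  grounded S f /\ attached S c p f.
Proof.
move=> cn; move: Q; elim/state_ind: S c p / cn.
- move=> c p Q _ _; split=> [A|i]; last by rewrite inE.
  by rewrite subset0 => ->.
- by move=> S c S0 Q _ /burn_nil_inv E; rewrite E eqxx in S0.
- move=> S u p IH Q cl /burn_pop_inv[->|/(IH _ (clear_pop cl)) [g a]]; split=> //.
  + by move=> A; rewrite subset0 => ->.
  + by move=> i; rewrite inE.
  + by move=> i /a /=; rewrite ltn0 andbF.
- move=> S j u p jS IH Q cl.
  case/burn_step_inv=> [->|[_ /(IH _ cl) [g a]]|[jS']|[jS']];
    try by rewrite jS' in jS.
  + split=> [A|i]; last by rewrite inE.
    by rewrite subset0 => ->.
  + split=> // i iS; have := a i iS; rewrite /= ltnS.
    by case/or3P=> [->//|/andP[-> /ltnW->]|->]; rewrite ?orbT.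
- move=> S j u p jS IH1 IH2 Q cl.
  case/burn_step_inv=> [E|[/negP[] //]|[_ Qj fj B]|[_ Qj fj B]];
    rewrite ?E ?inE ?jS // in jS *.
  + have [g a] := IH1 _ (clear_fire jS cl) B; split.
      move=> A AS A0; have [jA|jA] := boolP (j \in A).
        exists j => //; rewrite fj; apply: contraL jA => uA.
        have [_ /(_ u)] := cl; rewrite mem_head => /(_ isT).
        by rewrite (fintype.subsetP AS).
      apply: g => //; apply/fintype.subsetP=> i iA; rewrite !inE (fintype.subsetP AS) // andbT.
      by apply: contraNneq jA => <-.
    move=> i iS; have [->|ij] := eqVneq i j.
      by rewrite fj /= eqxx ltnSn orbT.
    have := a i; rewrite !inE ij iS => /(_ isT) /=.
    case/or4P=> [/andP[_ ->]//|/andP[/eqP-> _]|/andP[-> H]|->]; rewrite ?orbT ?jS //.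
    by rewrite ltnS ltnW ?orbT.
  + have [g a] := IH2 _ cl B; split=> // i iS; have := a i iS; rewrite /= ltnS.
    by case/or3P=> [->//|/andP[-> /ltnW->]|->]; rewrite ?orbT.
Qed.

(** Burning [j] outside [A] takes [j] out of [S :\: A] but adds a pending check by [j] for every
    vertex of [A], so the bound is unchanged. A check that lowers [Q j] lowers value and bound at
    [j] alike. *)
Lemma burn_parking f S c p Q : c <= n -> burn f S c p Q -> parking S c p Q.
Proof.
move=> cn; move: Q; elim/state_ind: S c p / cn.
- by move=> c p Q _ A; rewrite subset0 => ->.
- by move=> S c S0 Q /burn_nil_inv E; rewrite E eqxx in S0.
- move=> S u p IH Q /burn_pop_inv[->|/IH]; last exact.
  by move=> A; rewrite subset0 => ->.
- move=> S j u p jS IH Q.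
  case/burn_step_inv=> [->|[_ /IH pk]|[jS']|[jS']]; try by rewrite jS' in jS.
    by move=> A; rewrite subset0 => ->.
  move=> A AS A0; have [i iA Qi] := pk A AS A0; exists i => //.
  by move: Qi; rewrite slots_skip; move: (slots _ _ _) => a; lia.
- move=> S j u p jS IH1 IH2 Q.
  case/burn_step_inv=> [E|[/negP[] //]|[_ Qj fj B]|[_ Qj fj B]];
    rewrite ?E ?inE ?jS // in jS *.
  + move=> A AS A0; have [jA|jA] := boolP (j \in A).
      by exists j => //; rewrite Qj /= ltnSn.
    have AS' : A \subset S :\ j by rewrite subsetD1 AS.
    have [i iA Qi] := IH1 _ B A AS' A0; exists i => //.
    have ij : i != j by apply: contraNneq jA => <-.
    move: Qi; rewrite slots_fire // (cardsD1 j (S :\: A)) !inE jA jS /=.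
    rewrite (_ : S :\ j :\: A = (S :\: A) :\ j); first by rewrite addSn add1n addnS.
    by apply/setP=> k; rewrite !inE; do !case: (_ \in _); rewrite ?andbF ?andbT.
  + move=> A AS A0; have [i iA Qi] := IH2 _ B A AS A0; exists i => //.
    move: Qi Qj; rewrite slots_skip; move: (slots _ _ _) #|_| => a b.
    by case: (eqVneq i j) => [->|]; lia.
Qed.

(** The same bookkeeping preserves the condition along the run, which cannot get stuck: on an empty
    path the bound for [A = S] would be [0]. *)
Lemma parking_burn S c p Q : c <= n -> clear S p -> parking S c p Q ->
  exists f, burn f S c p Q.
Proof.
move=> cn; move: Q; elim/state_ind: S c p / cn.
- by move=> c' p' Q _ _; exists id; apply: BurnDone.
- move=> S c S0 Q _ pk; have [j _] := pk S (subxx S) S0.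
  by rewrite setDv cards0.
- move=> S u p IH Q /clear_pop cl /(IH _ cl) [f B].
  by exists f; apply: BurnPop.
- move=> S j u p jS IH Q cl pk; have [|f B] := IH Q cl.
    move=> A AS A0; have [i iA Qi] := pk A AS A0; exists i => //.
    move: Qi; rewrite slots_skip (_ : i == j = false) ?addn0 //.
    by apply: contraNF jS => /eqP <-; apply: (fintype.subsetP AS).
  by exists f; apply: BurnSkip.
- move=> S j u p jS IH1 IH2 Q cl pk.
  have [Qj|Qj] := posnP (Q j).
    have cl' := clear_fire jS cl.
    have [A|f B] := IH1 Q cl'.
      rewrite subsetD1 => /andP[AS jA] A0.
      have [i iA Qi] := pk A AS A0; exists i => //.
      have ij : i != j by apply: contraNneq jA => <-.
      move: Qi; rewrite slots_fire // (cardsD1 j (S :\: A)) !inE jA jS /=.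
      rewrite (_ : S :\ j :\: A = (S :\: A) :\ j); first by rewrite addnA addn1.
      by apply/setP=> k; rewrite !inE; do !case: (_ \in _); rewrite ?andbF ?andbT.
    exists (fun i => if i == j then u else f i); apply: BurnFire; rewrite ?eqxx //.
    apply: burn_ext B => // i /setD1P[ij _].
    by rewrite (negPf ij).
  have [A AS A0|f B] := IH2 (fun i => Q i - (i == j)) cl.
    have [i iA Qi] := pk A AS A0; exists i => //.
    move: Qi Qj; rewrite slots_skip; move: (slots _ _ _) #|_| => a b.
    by case: (eqVneq i j) => [->|]; lia.
  exists f; apply: BurnDamp => //.
  (* After its check of [j], the vertex [u] is neither unburnt nor still allowed as a parent of [j],
     which forces [f j != u]. *)
  have [_ a] := burn_grounded (ltnW (ltn_ord j)) cl B.
  apply/eqP=> fj; have := a j jS; rewrite fj /= ltnn andbF.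
  case: cl => /= /andP[uP _] /(_ u); rewrite mem_head => /(_ isT) /negPf -> /=.
  by move/allowed_mem => uP'; rewrite uP' in uP.
Qed.

(** The values are rebuilt from the end of the run: [0] when [j] burns, and one more for each
    earlier check of [j]. *)
Lemma grounded_burn S c p f : c <= n -> clear S p -> grounded S f ->
  attached S c p f -> exists Q, burn f S c p Q.
Proof.
move=> cn; elim/state_ind: S c p / cn.
- by move=> c' p' _ _ _; exists (fun _ => 0); apply: BurnDone.
- move=> S c S0 _ g a; have [j jS] := g S (subxx S) S0.
  by have := a j jS; rewrite orbF => ->.
- move=> S u p IH /clear_pop cl g a; have [|Q B] := IH cl g.
    by move=> i /a /=; rewrite ltn0 andbF.
  by exists Q; apply: BurnPop.
- move=> S j u p jS IH cl g a; have [|Q B] := IH cl g.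
    move=> i iS; have := a i iS; rewrite /= ltnS.
    suff -> : (i <= j) = (i < j) by [].
    rewrite [RHS]ltn_neqAle; case: eqVneq => // /val_inj E.
    by rewrite -E iS in jS.
  by exists Q; apply: BurnSkip.
- move=> S j u p jS IH1 IH2 cl g a.
  have [fj|fj] := eqVneq (f j) u.
    have cl' := clear_fire jS cl.
    have [||Q B] := IH1 cl'.
    + by move=> A; rewrite subsetD1 => /andP[AS _]; apply: g.
    + move=> i /setD1P[ij iS]; have := a i iS; rewrite !inE /= ltn_ord andbT ltnS.
      rewrite [i <= j]leq_eqVlt val_eqE (negPf ij) /=.
      by case: (eqVneq (f i) j) => [//|_] /=.
    exists (fun i => if i == j then 0 else Q i); apply: BurnFire; rewrite ?eqxx //.
    apply: burn_ext B => // i /setD1P[ij _].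
    by rewrite (negPf ij).
  have [|Q B] := IH2 cl g.
    move=> i iS; have := a i iS; rewrite /= ltnS leq_eqVlt val_eqE.
    by have [->|//] := eqVneq i j; rewrite (negPf fj).
  exists (fun i => Q i + (i == j)); apply: BurnDamp; rewrite ?eqxx ?addn1 //.
  apply: burn_ext B => //; first exact/ltnW.
  by move=> i _; rewrite addnK.
Qed.

(** * Counting the checks of a run *)

Definition inversions f (r j : 'I_n) : nat :=
  \sum_(i | [&& i != r, fconnect f j i & j < i]) 1.

Definition anchored f (r : 'I_n) p :=
  if p is u :: p' then fpath f u p' && (last u p' == r) else true.

(** The counter of a path vertex below the top is its child on the path, so its check of [j] is
    pending exactly when that child exceeds [j]; these children are the non-root path vertices. *)
Lemma slots_path_sum (r : 'I_n) u p (j : nat) : uniq (u :: p) -> last u p = r ->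
  slots u p j = \sum_(i <- u :: p | (i != r) && (j < i)) 1.
Proof.
elim: p u => [|v p IH] u; first by move=> _ /= ->; rewrite big_cons big_nil eqxx.
rewrite cons_uniq => /andP[up Uvp] lp; rewrite big_cons [slots _ _ _]/= IH //.
have -> /= : u != r.
  by apply: contraNneq up => ->; rewrite -lp /= mem_last.
by case: ltnP => _; rewrite ?add0n.
Qed.

(* Tree edges, lowered values and inversions together account for all pairs that
   are still to be checked. *)
Lemma burn_weight f (r : 'I_n) S c p Q : f r = r -> c <= n -> clear S p ->
  anchored f r p -> burn f S c p Q ->
  \sum_(j in S) Q j + #|S| + \sum_(j in S) inversions f r j
  = \sum_(j in S) slots c p j + 'C(#|S|, 2).
Proof.
move=> fr cn; move: Q; elim/state_ind: S c p / cn.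
- by move=> c p Q _ _ _; rewrite !big_set0 cards0.
- by move=> S c S0 Q _ _ /burn_nil_inv E; rewrite E eqxx in S0.
- move=> S u p IH Q cl an /burn_pop_inv[->|B]; first by rewrite !big_set0 cards0.
  rewrite (IH _ (clear_pop cl) _ B) //.
  by case: p an {IH cl B} => //= v p /andP[/andP[_ ->] ->].
- move=> S j u p jS IH Q cl an.
  case/burn_step_inv=> [->|[_ B]|[jS']|[jS']]; try by rewrite jS' in jS.
    by rewrite !big_set0 cards0.
  rewrite (IH _ cl an B); congr addn; apply: eq_bigr => i iS.
  rewrite slots_skip (_ : i == j = false) ?addn0 //.
  by apply: contraNF jS => /eqP <-.
- move=> S j u p jS IH1 IH2 Q cl an.
  case/burn_step_inv=> [E|[/negP[] //]|[_ Qj fj B]|[_ Qj fj B]];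
    rewrite ?E ?inE ?jS // in jS *.
  + have := IH1 _ (clear_fire jS cl) _ B; rewrite /= fj eqxx => /(_ an).
    have -> : \sum_(i in S :\ j) slots n [:: j, u & p] i
      = #|S :\ j| + \sum_(i in S :\ j) slots j.+1 (u :: p) i.
      rewrite -sum1_card -big_split; apply: eq_bigr => i /setD1P[ij _].
      by rewrite slots_fire.
    (* The checks of [j] pending at the ancestors of [u] will never happen; each corresponds to a
       non-root ancestor of [j] larger than [j]. *)
    have inv_j : inversions f r j = slots u p j.
      case: cl an => Uup _ /= /andP[fp /eqP lp].
      rewrite (slots_path_sum _ Uup lp) -[RHS]big_filter big_uniq ?filter_uniq //.
      apply: eq_bigl => i; rewrite mem_filter fconnect_eqVf fj.
      rewrite (fconnect_fpath i fr fp lp).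
      case: (eqVneq j i) => [->|_] /=; rewrite ?ltnn ?andbF //.
      by rewrite andbAC andbA.
    rewrite !(big_setD1 j jS) /= Qj inv_j (cardsD1 j S) jS add1n binS bin1 ltnSn.
    move: (\sum_(i in S :\ j) Q i) (\sum_(i in S :\ j) inversions f r i).
    move: (\sum_(i in S :\ j) _) #|S :\ j| 'C(_, _) (slots _ _ _).
    lia.
  + have := IH2 _ cl an B; rewrite !(big_setD1 j jS) /= eqxx.
    rewrite [X in _ - _ + X](_ : _ = \sum_(i in S :\ j) Q i); last first.
      by apply: eq_bigr => i /setD1P[/negPf-> _]; rewrite subn0.
    have -> : \sum_(i in S :\ j) ((i < j) + slots u p i)
      = \sum_(i in S :\ j) ((i < j.+1) + slots u p i).
      apply: eq_bigr => i /setD1P[/negPf ij _].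
      by have := slots_skip j u p i; rewrite ij addn0.
    rewrite ltnn ltnSn; move: Qj (\sum_(i in S :\ j) Q i) => /=.
    move: (\sum_(i in S :\ j) _) (\sum_(i in S :\ j) _) #|S| 'C(_, _).
    move: (slots _ _ _) (inversions _ _ _); lia.
Qed.

End Burning.

(** * Rooted trees as parent functions *)

Lemma set2_eq (V : finType) (a b c d : V) : [set a; b] = [set c; d] ->
  (a = c /\ b = d) \/ (a = d /\ b = c).
Proof.
move=> E.
have: a \in [set c; d] by rewrite -E set21.
have: b \in [set c; d] by rewrite -E set22.
have: c \in [set a; b] by rewrite E set21.
have: d \in [set a; b] by rewrite E set22.
by do 4![case/set2P=> ?]; subst; auto.
Qed.

Section ParentFunctions.

Variable V : finType.
Implicit Types (r : V) (f : V -> V) (T : rooted_graph V).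

Definition tree_of r f : rooted_graph V :=
  RootedGraph r [set [set j; f j] | j in [set~ r]].

Lemma adj_treeP r f u v :
  reflect ((u != r /\ f u = v) \/ (v != r /\ f v = u)) (adj (tree_of r f) u v).
Proof.
apply: (iffP imsetP) => [[j]|[[ur <-]|[vr <-]]].
- by rewrite !inE => jr /set2_eq[[-> ->]|[-> ->]]; [left|right].
- by exists u; rewrite ?inE.
- by exists v; rewrite ?inE 1?setUC.
Qed.

Lemma adj_sym T : ssrbool.symmetric (adj T).
Proof. by move=> u v; rewrite /adj setUC. Qed.

Lemma connect_simple_path T u v : connect (adj T) u v ->
  exists p, simple_path T u p v.
Proof.
case/connectP=> p pp ->; case/shortenP: pp => p' pp' up' _.
by exists p'.
Qed.

Section Grounded.

Variables (r : V) (f : V -> V).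
Hypotheses (fr : f r = r) (gf : grounded [set~ r] f).
Let T := tree_of r f.
Let depth j := findex f j r.

(** The vertices that never reach [r] form a set closed under [f], hence an empty one. *)
Lemma fconnect_root j : fconnect f j r.
Proof.
set A := [set j | ~~ fconnect f j r].
have [A0|A0] := eqVneq A set0.
  by have := in_set0 j; rewrite -A0 inE => /negbFE.
have [|i] := gf _ A0.
  by apply/fintype.subsetP=> i; rewrite !inE; apply: contraNneq => ->.
rewrite !inE negbK => + fi; rewrite fconnect_eqVf fi.
by rewrite orbT.
Qed.

Lemma depth_parent j : j != r -> depth (f j) < depth j.
Proof. by rewrite eq_sym /depth => /(fconnect_findex (fconnect_root j)) ->. Qed.

Lemma parent_neq j : j != r -> f j != j.
Proof.
by move=> /depth_parent; apply: contraTneq => ->; rewrite ltnn.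
Qed.

(** Depth does not grow along [f], so [f u] is strictly less deep than [u], and [u] is at most as
    deep as [j]. *)
Lemma fconnect_parent u j : u != r -> fconnect f j u -> f u != j.
Proof.
move=> ur /iter_findex E.
have depth_iter k w : depth (iter k f w) <= depth w.
  elim: k => //= k; apply: leq_trans.
  have [->|/depth_parent/ltnW//] := eqVneq (iter k f w) r.
  by rewrite fr.
have := depth_iter (findex f j u) j; rewrite E => H.
by apply: contraTneq (depth_parent ur) => ->; rewrite -leqNgt.
Qed.

Lemma tree_connected u v : connect (adj T) u v.
Proof.
have to_r w : connect (adj T) w r.
  apply: connect_sub (fconnect_root w) => x y /eqP <-.
  have [->|xr] := eqVneq x r; first by rewrite fr connect0.
  by apply: connect1; apply/adj_treeP; left.
apply: connect_trans (to_r u) _.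
by rewrite (sym_connect_sym (@adj_sym T)).
Qed.

(** A deepest vertex of a cycle has two distinct neighbours on it, and both would have to be its
    parent. *)
Lemma tree_acyclic (c : seq V) : 2 < size c -> ~ ucycle (adj T) c.
Proof.
case: c => // x c' sc uc; set c := x :: c' in sc uc.
have xc : x \in c by rewrite mem_head.
case: (@arg_maxnP _ x (mem c) depth xc) => v vc max_v.
have {}max_v w : w \in c -> depth w <= depth v by apply: max_v.
case: (rot_to vc) => k s E.
move: uc; rewrite -(rot_ucycle k) E => /andP[].
have mc w : (w \in c) = (w \in v :: s) by rewrite -E mem_rot.
move: sc; rewrite -(size_rot k) E; case: s E mc => [|w [|t s]] //= E mc _.
rewrite rcons_path => /and4P[vw wt pt lv] /and4P[_ w_ts _ _].
have parent_of z : z \in v :: w :: t :: s -> adj T v z -> z = f v.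
  move=> zc /adj_treeP[[_ ->//]|[zr fz]].
  by have := depth_parent zr; rewrite fz ltnNge max_v // mc.
have Ew : w = f v by apply: parent_of; rewrite // !inE eqxx orbT.
have El : last t s = f v.
  apply: parent_of; last by rewrite adj_sym.
  by rewrite !in_cons orbA orbC -in_cons mem_last.
by rewrite Ew -El mem_last in w_ts.
Qed.

Lemma tree_of_rooted : rooted_tree T.
Proof.
split; last exact: tree_acyclic.
- move=> e /imsetP[j]; rewrite !inE => jr ->.
  by rewrite cards2 eq_sym parent_neq.
- by move=> u v; apply/connect_simple_path/tree_connected.
Qed.

(** A step up from [u] would lead to [f u]. The side condition forbids it, and a step down restores
    the condition because the path does not revisit the vertex it leaves. *)
Lemma tree_path_down u (p : seq V) : path (adj T) u p -> uniq (u :: p) ->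
  u = r \/ f u \notin p -> path (fun a b => f b == a) u p.
Proof.
elim: p u => //= w p IH u /andP[uw pw] /andP[uwp uw'] H.
have /andP[w_p U] := uw'.
case/adj_treeP: uw => [[ur fu]|[wr fw]].
  by case: H => [E|]; [rewrite E eqxx in ur | rewrite fu mem_head].
rewrite fw eqxx; apply: IH => //; right; rewrite fw.
by apply: contra uwp; rewrite inE orbC => ->.
Qed.

Lemma ancestor_tree i j : ancestor T i j = (i != j) && fconnect f j i.
Proof.
have memP p : simple_path T r p j -> (i \in r :: p) = fconnect f j i.
  case=> pp lp up.
  have := tree_path_down pp up (or_introl erefl).
  (* Read backwards, the path from the root follows [f] from [j] up to [r]. *)
  rewrite -rev_path lp => fp.
  rewrite (fconnect_fpath i fr fp); last first.
    by case: (p) lp => //= a s _; rewrite rev_cons last_rcons.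
  by rewrite -mem_rev lastI rev_rcons lp.
rewrite /ancestor; congr andb; apply/asboolP/idP.
  by case=> p /memP ->.
move=> c; have [p sp] := connect_simple_path (tree_connected r j).
by exists p; rewrite ?(memP p).
Qed.

Lemma par_tree j : j != r -> par T j = f j.
Proof.
move=> jr; rewrite /par; case: pickP => [u /andP[/adj_treeP[[ur fu]|[_ ->//]]]|].
  by rewrite ancestor_tree => /andP[_ /(fconnect_parent ur)]; rewrite fu eqxx.
move/(_ (f j)); rewrite ancestor_tree parent_neq // fconnect1 !andbT.
by move/negP; case; apply/adj_treeP; right.
Qed.

End Grounded.

(** Connectedness gives each non-root vertex a neighbour closer to the root, taken as its parent;
    acyclicity leaves no further edges. *)
Lemma rooted_tree_of T : rooted_tree T ->
  exists f, [/\ f (Defs.root T) = Defs.root T, grounded [set~ Defs.root T] f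
              & T = tree_of (Defs.root T) f].
Proof.
case=> card2 conn acyc; set r := Defs.root T.
pose reach v k := `[< exists p, [/\ path (adj T) r p, last r p = v & size p = k] >].
have reach_ex v : exists k, reach v k.
  by have [p [pp lp _]] := conn r v; exists (size p); apply/asboolP; exists p.
pose d v := ex_minn (reach_ex v).
have d_ex j : j != r -> exists u, adj T u j && (d u < d j).
  move=> jr; rewrite [d j]/d; case: ex_minnP => k /asboolP[p [pp lp <-]] _.
  case/lastP: p pp lp => [_ /= E|p x]; first by rewrite E eqxx in jr.
  rewrite rcons_path last_rcons size_rcons => /andP[pp ax] <-.
  exists (last r p); rewrite ax ltnS /d; case: ex_minnP => m _; apply.
  by apply/asboolP; exists p.
pose f j := if j == r then r else odflt j [pick u | adj T u j && (d u < d j)].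
have fP j : j != r -> adj T (f j) j && (d (f j) < d j).
  move=> jr; rewrite /f (negPf jr); case: pickP => //= H.
  by have [u Hu] := d_ex j jr; rewrite H in Hu.
have fr : f r = r by rewrite /f eqxx.
have gf : grounded [set~ r] f.
  move=> A Ar /set0Pn[x xA].
  case: (@arg_minnP _ x (mem A) d xA) => j jA min_j.
  exists j => //; apply/negP=> /min_j.
  have /fP/andP[_] : j != r by have := fintype.subsetP Ar j jA; rewrite !inE.
  by rewrite ltnNge => /negP.
exists f; split=> //.
have sub : subrel (adj (tree_of r f)) (adj T).
  by move=> u v /adj_treeP[[/fP/andP[+ _] <-]|[/fP/andP[+ _] <-]] //; rewrite adj_sym.
suff E : edges T = edges (tree_of r f) by move: E; rewrite /r; case: (T) => x e /= ->.
apply/setP=> e; apply/idP/idP => [eT|]; last first.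
  by case/imsetP=> j; rewrite !inE => /fP/andP[+ _] ->; rewrite adj_sym.
have /eqP/cards2P[a [b [ab Ee]]] := card2 _ eT.
have aT : adj T a b by rewrite /adj -Ee.
case: (boolP (adj (tree_of r f) a b)) => [|nab]; first by rewrite /adj -Ee.
have [p [pp lp up]] := connect_simple_path (tree_connected fr gf a b).
(* The edge between [a] and [b] closes the path from [a] to [b] in the tree of [f], which has at
   least two edges, to a cycle. *)
case: (acyc (a :: p)).
  case: p pp lp up => [_ /= E|x [|y p]] //=; first by rewrite E eqxx in ab.
  by move=> /andP[ax _] E; rewrite -E ax in nab.
rewrite /ucycle up andbT /= rcons_path lp (adj_sym T b) aT andbT.
exact: sub_path sub _ _ pp.
Qed.

End ParentFunctions.

(** * [kappa] and uprootedness through parent functions *)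

Lemma kappa_tree (n : nat) (r : 'I_n) (f : 'I_n -> 'I_n) :
  f r = r -> grounded [set~ r] f ->
  kappa (complete_graph 'I_n) (tree_of r f) = \sum_(j in [set~ r]) inversions f r j.
Proof.
move=> fr gf; rewrite /kappa /inversions /=.
rewrite (exchange_big_dep (fun j => j \in [set~ r])) /=; last first.
  by move=> i j _ /andP[]; rewrite !inE.
apply: eq_bigr => j; rewrite !inE => jr; apply: eq_big => i.
  rewrite jr ancestor_tree //=; case: (eqVneq i j) => [->|//].
  by rewrite ltnn !andbF.
(* Each pair counts once in the complete graph, since the parent of [i] lies above [i] and so
   differs from its descendant [j]. *)
case/and4P=> ir _ + ji; rewrite ancestor_tree // par_tree // => /andP[ij cji].
rewrite -[RHS]/(nat_of_bool true); congr nat_of_bool.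
exact: (fconnect_parent fr gf ir cji).
Qed.

(** A non-root parent lies in [[set~ r]], so [attached] only constrains the children of the root;
    the initial counter [r] lets the root burn just the smaller vertices. *)
Lemma uprooted_treeP (n : nat) (r : 'I_n) (f : 'I_n -> 'I_n) :
  f r = r -> grounded [set~ r] f ->
  uprooted (tree_of r f) <-> attached [set~ r] r [:: r] f.
Proof.
move=> fr gf; split=> [[_ H] j|H].
  rewrite !inE /= orbF => jr; case: eqP => //= E.
  by apply: H => //=; rewrite par_tree.
split; first exact: tree_of_rooted.
move=> j /= jr; rewrite par_tree // => E.
by have := H j; rewrite !inE jr /= E eqxx orbF /=; apply.
Qed.

(** * Monomial ideals and inequalities for spherical parking functions *)

Section MonomialIdeals.

Import GRing.Theory.
Local Open Scope ring_scope.

(** The coefficient at [P] must come from some [c i * g i], all of whose monomials are multiples of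
    ['X_[m i]]. *)
Lemma ideal_gen_monomialP (K : fieldType) (n : nat) (I : finType) (D : pred I)
    (g : I -> {mpoly K[n]}) (m : I -> 'X_{1..n}) (P : 'X_{1..n}) :
  (forall i, g i = 'X_[m i]) ->
  ideal_gen D g 'X_[P] <-> exists2 i, D i & (m i <= P)%MM.
Proof.
move=> gE; split=> [[c]|[i Di mP]]; last first.
  exists (fun k => if k == i then 'X_[(P - m i)%MM] else 0).
  rewrite (bigD1 i) //= eqxx gE -mpolyXD submK // big1 ?addr0 // => k /andP[_].
  by move/negPf->; rewrite mul0r.
move/(congr1 (mcoeff P)); rewrite mcoeffX eqxx raddf_sum /= => E.
have [//|N] := pselect (exists2 i, D i & (m i <= P)%MM).
have /eqP := oner_neq0 K; case; rewrite -[LHS]/(true%:R) E big1 // => i Di.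
apply/eqP; rewrite mcoeff_eq0; apply/negP => /msuppM_le; rewrite gE msuppX.
case/allpairsP=> -[p1 p2] /= [_]; rewrite inE => /eqP -> EP.
by apply: N; exists i; rewrite // EP lem_addl.
Qed.

Lemma outdeg_complete (n : nat) (A : {set 'I_n}) i : i \in A ->
  outdeg (complete_graph 'I_n.+1) A i = (n.+1 - #|A|)%N.
Proof.
move=> iA; rewrite /outdeg (eq_bigr (fun _ => 1%N)) => [|j].
  rewrite sum1_card cardsCs setCK card_ord card_imset //.
  exact: lift_inj.
rewrite inE => jA; rewrite /= (_ : _ != j) //.
by apply: contraNneq jA => <-; rewrite imset_f.
Qed.

Lemma complete_gen_monomial (K : fieldType) (n : nat) (A : {set 'I_n}) :
  gen_monomial K (complete_graph 'I_n.+1) A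
  = 'X_[[multinom if i \in A then (n.+1 - #|A|)%N else 0%N | i < n]].
Proof.
rewrite mpolyXE_id /gen_monomial big_mkcond; apply: eq_bigr => i _.
by rewrite mnmE; case: ifP => // iA; rewrite outdeg_complete.
Qed.

End MonomialIdeals.

(** The generator of the full set is the product of all variables, and the skeleton of index [n - 2]
    is generated by the proper subsets. So only the full set may give a divisor, which yields
    positivity and one strict inequality per proper subset. *)
Lemma sPF_completeP (K : fieldType) (n : nat) (P : 'X_{1..n}) : 2 <= n ->
  sPF K (complete_graph 'I_n.+1) P <->
  (forall i, 0 < P i) /\
  (forall A : {set 'I_n}, A != set0 -> A != setT ->
     exists2 j, j \in A & P j < n.+1 - #|A|).
Proof.
move=> n2; rewrite /sPF /parking_ideal /skeleton_ideal.
rewrite !(ideal_gen_monomialP _ _ (complete_gen_monomial K (n := n))).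
have leP (A : {set 'I_n}) :
    ([multinom if i \in A then n.+1 - #|A| else 0 | i < n] <= P)%MM <->
    {in A, forall i, n.+1 - #|A| <= P i}.
  split=> [/mnm_lepP H i iA|H]; first by have := H i; rewrite mnmE iA.
  by apply/mnm_lepP=> i; rewrite mnmE; case: ifP => // /H.
have cardT (A : {set 'I_n}) : (#|A| <= (n - 2).+1) = (A != setT).
  rewrite -[A == _]negbK -properT properEneq subsetT andbT negbK.
  rewrite eqEcard subsetT /= cardsT card_ord; lia.
split=> [[[A A0 /leP PA] N]|[P0 H]].
  have H (B : {set 'I_n}) : B != set0 -> B != setT ->
      exists2 j, j \in B & P j < n.+1 - #|B|.
    move=> B0 BT; have [//|N'] := pselect (exists2 j, j \in B & P j < n.+1 - #|B|).
    case: N; exists B; first by rewrite B0 cardT.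
    apply/leP=> i iB; rewrite leqNgt; apply/negP=> Pi.
    by apply: N'; exists i.
  split=> // i; have [AT|AT] := eqVneq A setT.
    by have := PA i; rewrite AT inE cardsT card_ord subSnn; apply.
  by have [j jA] := H A A0 AT; rewrite ltnNge PA.
split.
  exists setT.
    by apply/set0Pn; exists (Ordinal (ltnW n2)); rewrite inE.
  by apply/leP=> i _; rewrite cardsT card_ord subSnn.
case=> A /andP[A0]; rewrite cardT => AT /leP PA.
by have [j jA] := H A A0 AT; rewrite ltnNge PA.
Qed.

(** * Spherical parking functions as runs *)

Section Encoding.

Variable n : nat.
Implicit Types (r : 'I_n) (f : 'I_n -> 'I_n) (P : 'X_{1..n}).

(* [r] is the largest vertex with [P r = 1]; lowering [P] by [1], and by [1]
   more above [r], accounts for the root checking all vertices above [r]. *)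
Definition encodes P r f := [/\ f r = r, P r = 1,
  forall j, j != r -> (r < j).+1 <= P j &
  burn f [set~ r] r [:: r] (fun j => P j - (r < j).+1)].

Lemma clear_root r : clear [set~ r] [:: r].
Proof. by split=> // i; rewrite !inE => ->. Qed.

Let le_n r : r <= n := ltnW (ltn_ord r).

Lemma encodes_grounded P r f : encodes P r f ->
  grounded [set~ r] f /\ attached [set~ r] r [:: r] f.
Proof. by case=> _ _ _; apply: burn_grounded (le_n r) (clear_root r). Qed.

(** Of two distinct candidates the larger lies above the other, which forces its value to be at
    least [2] instead of [1]. *)
Lemma encodes_root P r r' f f' : encodes P r f -> encodes P r' f' -> r = r'.
Proof.
move=> [_ Pr H _] [_ Pr' H' _]; apply/eqP/negPn/negP=> rr'.
have := H' r rr'; have := H r'; rewrite eq_sym rr' Pr Pr' => /(_ isT).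
by move: rr'; rewrite -val_eqE /=; lia.
Qed.

(** With [b] the size of [[set~ r] :\: A], this matches the shift by [(r < j).+1]: the parking bound
    of the initial state becomes [n.+1 - #|A|]. *)
Lemma slots_root r (j : 'I_n) (b : nat) : j != r ->
  slots r [:: r] j + b = b.+1 - (r < j).
Proof. by rewrite -val_eqE /= => jr; lia. Qed.

Lemma encodes_sPF (K : fieldType) P r f : 2 <= n ->
  encodes P r f -> sPF K (complete_graph 'I_n.+1) P.
Proof.
move=> n2 [fr Pr P0 B]; apply/sPF_completeP => //; split.
  by move=> i; have [->|/P0] := eqVneq i r; [rewrite Pr | lia].
move=> A A0 AT; have [rA|rA] := boolP (r \in A).
  exists r => //; rewrite Pr; have : A \proper setT by rewrite properT.
  by move/proper_card; rewrite cardsT card_ord; lia.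
have Ar : A \subset [set~ r] by rewrite subsetC sub1set inE.
have [j jA Qj] := burn_parking (le_n r) B Ar A0; exists j => //.
have jr : j != r by apply: contraNneq rA => <-.
have : #|A| + #|[set~ r] :\: A| = n.-1.
  by have := cardsID A [set~ r]; rewrite (setIidPr Ar) cardsC1 card_ord.
by have := P0 j jr; move: Qj; rewrite slots_root //=; move: #|A| #|_ :\: _| => a b; lia.
Qed.

Lemma sPF_encodes (K : fieldType) P : 2 <= n ->
  sPF K (complete_graph 'I_n.+1) P -> exists r f, encodes P r f.
Proof.
move=> n2 /(sPF_completeP K _ n2) [P0 H].
(* A set of [n - 1] vertices has bound [2], so one of its positive values is [1]. *)
have [r0 Pr0] : exists r, P r == 1.
  pose i0 := Ordinal (ltnW n2).
  have [||j _ Pj] := H [set~ i0].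
  - by rewrite -card_gt0 cardsC1 card_ord; lia.
  - by apply: contraTneq (in_setT i0) => <-; rewrite !inE eqxx.
  - by exists j; have := P0 j; move: Pj; rewrite cardsC1 card_ord; lia.
case: (@arg_maxnP _ r0 (fun j => P j == 1) val Pr0) => r /eqP Pr max_r.
have P1 j : j != r -> (r < j).+1 <= P j.
  move=> _; have := P0 j; case: (ltnP r j) => // rj.
  by have := max_r j; have [->|] := eqVneq (P j) 1; [move/(_ isT)=> /=|]; lia.
have pk : parking [set~ r] r [:: r] (fun j => P j - (r < j).+1).
  move=> A Ar A0.
  have rA : r \notin A by apply/negP=> /(fintype.subsetP Ar); rewrite !inE eqxx.
  have [|j jA Pj] := H A A0.
    by apply: contraNneq rA => ->; rewrite inE.
  have jr : j != r by apply: contraNneq rA => <-.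
  exists j => //; have : #|A| + #|[set~ r] :\: A| = n.-1.
    by have := cardsID A [set~ r]; rewrite (setIidPr Ar) cardsC1 card_ord.
  by move: Pj; have := P1 j jr; rewrite slots_root //=; move: #|A| #|_ :\: _| => a b; lia.
have [f B] := parking_burn (le_n r) (clear_root r) pk.
exists r, (fun i => if i == r then r else f i); split; rewrite ?eqxx //.
apply: burn_ext B => // i; rewrite !inE.
by move/negPf->.
Qed.

Lemma grounded_encodes r f : f r = r -> grounded [set~ r] f ->
  attached [set~ r] r [:: r] f -> exists P, encodes P r f.
Proof.
move=> fr gf af.
have [Q B] := grounded_burn (le_n r) (clear_root r) gf af.
exists [multinom if j == r then 1 else Q j + (r < j).+1 | j < n]; split=> //.
- by rewrite mnmE eqxx.
- by move=> j /negPf jr; rewrite mnmE jr leq_addl.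
apply: burn_ext B => // j; rewrite !inE mnmE.
by move/negPf->; rewrite addnK.
Qed.

Lemma encodes_inj P P' r f f' : {in [set~ r], f =1 f'} ->
  encodes P r f -> encodes P' r f' -> P = P'.
Proof.
move=> ff [_ Pr P1 B] [_ Pr' P1' B']; apply/mnmP=> j.
have [->|jr] := eqVneq j r; first by rewrite Pr Pr'.
have jS : j \in [set~ r] by rewrite !inE.
have B2 := burn_ext (le_n r) ff (fun _ _ => erefl) B.
have := burn_inj_Q (le_n r) B2 B' jS.
by have := P1 j jr; have := P1' j jr; lia.
Qed.

Lemma encodes_fun P r f f' : encodes P r f -> encodes P r f' ->
  {in [set~ r], f =1 f'}.
Proof. by move=> [_ _ _ B] [_ _ _ B']; apply: burn_inj_f (le_n r) B B'. Qed.

Lemma encodes_sum P r f : encodes P r f ->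
  \sum_(i < n) P i + kappa (complete_graph 'I_n) (tree_of r f) = 'C(n, 2).+1.
Proof.
move=> E; have [gf _] := encodes_grounded E.
case: E => fr Pr P1 B; rewrite kappa_tree //.
have := burn_weight fr (le_n r) (clear_root r) _ B.
rewrite /= eqxx => /(_ isT); rewrite cardsC1 card_ord.
have -> : \sum_(i < n) P i =
    (\sum_(j in [set~ r]) (P j - (r < j).+1) + \sum_(j in [set~ r]) (r < j).+1).+1.
  rewrite (bigD1 r) //= Pr add1n -big_split; congr _.+1.
  rewrite [RHS](eq_bigl (fun i => i != r)) => [|i]; last by rewrite !inE.
  by apply: eq_bigr => j jr /=; rewrite subnK // P1.
(* Each non-root [j] contributes [2] whatever [r] is: the constant [1] of the shift, and another [1]
   either from the extra shift above [r] or from the pending check by the root below [r]. *)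
have sum_side : \sum_(j in [set~ r]) (r < j).+1
    + \sum_(j in [set~ r]) ((j < r) + 0) = 2 * n.-1.
  rewrite -big_split /= (eq_bigr (fun _ => 2)).
    by rewrite sum_nat_const cardsC1 card_ord mulnC.
  by move=> j; rewrite !inE -val_eqE /=; lia.
have -> : 'C(n, 2) = n.-1 + 'C(n.-1, 2).
  by case: n r {sum_side B P1 gf fr f Pr P} => [[]|m _] //=; rewrite binS bin1 addnC.
move: sum_side; move: (\sum_(j in _) _) (\sum_(j in _) _) (\sum_(j in _) _).
move=> a b c; move: (\sum_(j in _) _) 'C(_, _); lia.
Qed.

End Encoding.

(** * The bijection and the sum formula *)

Theorem theorem2p9 (K : fieldType) (n : nat) (hn : (2 <= n)%N) :
  exists phi : 'X_{1..n} -> rooted_graph 'I_n,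
    set_bij (sPF K (complete_graph 'I_n.+1)) (@uprooted n) phi /\
    (forall P : 'X_{1..n}, sPF K (complete_graph 'I_n.+1) P ->
       Posz (\sum_(i < n) P i)%N
       = (Posz 'C(n, 2) - Posz (kappa (complete_graph 'I_n) (phi P)) + 1)%R).
Proof.
have total (P : 'X_{1..n}) : exists T, sPF K (complete_graph 'I_n.+1) P ->
    exists r f, T = tree_of r f /\ encodes P r f.
  have [PK|N] := pselect (sPF K (complete_graph 'I_n.+1) P).
    have [r [f E]] := sPF_encodes hn PK.
    by exists (tree_of r f) => _; exists r, f.
  (* An arbitrary value for [P] outside [sPF]. *)
  by exists (RootedGraph (Ordinal (ltnW hn)) set0) => /N.
have [phi phiP] := choice total; exists phi; split; last first.
  move=> P /phiP[r [f [-> /encodes_sum]]]; lia.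
split.
- move=> P /= /phiP[r [f [-> E]]].
  have [gf af] := encodes_grounded E; have [fr _ _ _] := E.
  exact/uprooted_treeP.
- move=> P P' /set_mem/phiP[r [f [-> E]]] /set_mem/phiP[r' [f' [-> E']]] TT.
  have rr' : r = r' by have := congr1 (@Defs.root _) TT.
  rewrite -{r'}rr' in E' TT.
  apply: (encodes_inj _ E E') => j; rewrite !inE => jr.
  have [gf _] := encodes_grounded E; have [fr _ _ _] := E.
  have [gf' _] := encodes_grounded E'; have [fr' _ _ _] := E'.
  by rewrite -(par_tree fr gf jr) TT par_tree.
- move=> T /= UT; have [tT _] := UT; have [f [fr gf ET]] := rooted_tree_of tT.
  have af : attached [set~ Defs.root T] (Defs.root T) [:: Defs.root T] f.
    by apply/uprooted_treeP; rewrite // -ET.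
  have [P E] := grounded_encodes fr gf af.
  have PK := encodes_sPF K hn E; exists P => //.
  (* The tree chosen for [P] also encodes [P], so it has the same root and the same parents as
     [T]. *)
  have [r' [f' [-> E']]] := phiP P PK.
  have rr' := encodes_root E' E; rewrite rr' in E' *.
  rewrite ET /tree_of /=; congr RootedGraph; apply: eq_in_imset => j jr.
  by rewrite (encodes_fun E' E jr).
Qed.
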